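(* Let $\alpha,\beta$ be real and $n\ge0$ an integer such that the HR polynomials below are well-defined. Let $$\overline{L_1^*}=z^2(z-1)\partial_z^2-z(2+\alpha+(-3+\beta)z)\partial_z+(1-\beta)zI,\qquad \overline{L_2^*}=z(z-1)\partial_z+(-1-\alpha+z)I.$$ Then the following are quasi-Laurent-polynomial eigenfunctions and eigenvalues of the adjoint generalized eigenvalue problem: for $j=3,4$, $$(\overline{L_1^*}-\mu^{(j)}_n\overline{L_2^*})\phi^{(j,n)*}(z)=0,\qquad \phi^{(j,n)*}(z)=w_j(z)\tilde p^{(j)}_n(z),$$ where $$w_3(z)=(1-z)^{\alpha+\beta}(-z)^{-1-\alpha-\beta},\quad\tilde p^{(3)}_n(z)=P_n(z^{-1};\beta-1,\alpha+1),\quad\mu^{(3)}_n=-n-1-\alpha-\beta;$$ $$w_4(z)=z^{-1},\quad\tilde p^{(4)}_n(z)=P_n(z^{-1};-\alpha-1,-\beta+1),\quad\mu^{(4)}_n=-n-1.$$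
   Context: HR polynomials: $P_n(z;a,b)=\frac{(b)_n}{(a+1)_n}\,{}_2F_1(-n,a+1;1-b-n;z)$, $(a)_n$ the Pochhammer symbol; well-defined when $(a+1)_n\ne0$ and $b\notin\{0,-1,\ldots,1-n\}$. $\partial_z=d/dz$. Powers are taken with any fixed holomorphic branch on a domain avoiding the branch points. (The operators $\overline{L_i^*}$ are the formal adjoints, on the unit circle, of $L_1=z(1-z)\partial_z^2+(1-\beta-(2+\alpha)z)\partial_z$ and $L_2=(1-z)\partial_z-(\alpha+1)I$.) *)

(* Defs.v *)
From Stdlib Require Import Reals Factorial.
From Coquelicot Require Import Coquelicot.

Open Scope C_scope.

Fixpoint pochhammer (a : C) (n : nat) : C :=
  match n with
  | O => 1
  | S k => pochhammer a k * (a + INR k)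
  end.

(* The terminating series 2F1(-n, b; c; z): since (-n)_k = 0 for k > n, only
   the terms k <= n occur ([sum_n u n] is u 0 + ... + u n).  Stopping at k = n
   is the usual convention when c is an integer <= -n, for which (c)_k may
   vanish beyond k = n. *)
Definition hyp2F1_neg (n : nat) (b c z : C) : C :=
  sum_n (G := C_AbelianMonoid)
    (fun k => pochhammer (- INR n) k * pochhammer b k
              / (pochhammer c k * INR (fact k)) * z ^ k) n.

Definition HR_poly (n : nat) (a b z : C) : C :=
  pochhammer b n / pochhammer (a + 1) n
  * hyp2F1_neg n (a + 1) (1 - b - INR n) z.

Definition HR_well_defined (n : nat) (a b : C) : Prop :=
  pochhammer (a + 1) n <> 0 /\
  (forall k : nat, (k < n)%nat -> b <> - INR k).

Definition Cexp (z : C) : C :=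
  (exp (Re z) * cos (Im z), exp (Re z) * sin (Im z))%R.

Definition connected_set (D : C -> Prop) : Prop :=
  forall U V : C -> Prop,
    open (T := C_UniformSpace) U -> open (T := C_UniformSpace) V ->
    (forall z, D z -> U z \/ V z) ->
    (forall z, D z -> ~ (U z /\ V z)) ->
    (forall z, D z -> U z) \/ (forall z, D z -> V z).

Definition is_domain (D : C -> Prop) : Prop :=
  (exists z, D z) /\ open (T := C_UniformSpace) D /\ connected_set D.

(* [f] is a holomorphic branch of the power g^s on the open set [D]: locally
   f = exp (s l) for a holomorphic logarithm l of g.  The logarithm is only
   required locally, so that single-valued powers (for instance s an integer)
   are covered also when g has no logarithm on the whole of [D]. *)
Definition is_power_branch (D : C -> Prop) (g : C -> C) (s : R) (f : C -> C)
  : Prop :=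
  forall z, D z -> exists l : C -> C,
    locally (T := C_UniformSpace) z (fun y =>
      ex_derive (V := C_NormedModule) l y /\
      Cexp (l y) = g y /\ f y = Cexp (s * l y)).

Definition L1_adj (alpha beta : R) (f : C -> C) (z : C) : C :=
  z ^ 2 * (z - 1) * C_derive (C_derive f) z
  - z * (2 + alpha + (-3 + beta) * z) * C_derive f z
  + (1 - beta) * z * f z.

Definition L2_adj (alpha : R) (f : C -> C) (z : C) : C :=
  z * (z - 1) * C_derive f z + (-1 - alpha + z) * f z.

(* [C_derive] is a total operator, meaningful only where the derivative exists;
   hence the explicit differentiability clauses. *)
Definition twice_differentiable_on (D : C -> Prop) (f : C -> C) : Prop :=
  forall z, D z ->
    ex_derive (V := C_NormedModule) f z /\
    ex_derive (V := C_NormedModule) (C_derive f) z.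

Definition is_gen_eigenfunction (D : C -> Prop) (A B : (C -> C) -> C -> C)
    (mu : C) (f : C -> C) : Prop :=
  twice_differentiable_on D f /\
  (exists z, D z /\ f z <> 0) /\
  (forall z, D z -> A f z - mu * B f z = 0).

Definition p3 (alpha beta : R) (n : nat) (z : C) : C :=
  HR_poly n (beta - 1) (alpha + 1) (/ z).

Definition mu3 (alpha beta : R) (n : nat) : R :=
  (- INR n - 1 - alpha - beta)%R.

Definition w4 (z : C) : C := / z.

Definition p4 (alpha beta : R) (n : nat) (z : C) : C :=
  HR_poly n (- alpha - 1) (- beta + 1) (/ z).

Definition mu4 (n : nat) : R := (- INR n - 1)%R.

(* [w] is w_3 = (1-z)^(alpha+beta) (-z)^(-1-alpha-beta) on [D] for some choice
   of holomorphic branches of the two powers. *)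
Definition is_w3 (D : C -> Prop) (alpha beta : R) (w : C -> C) : Prop :=
  exists u v : C -> C,
    is_power_branch D (fun z => 1 - z) (alpha + beta)%R u /\
    is_power_branch D (fun z => - z) (-1 - alpha - beta)%R v /\
    forall z, D z -> w z = u z * v z.

(* Main.v *)
Require Import Defs.
From Stdlib Require Import Reals Lra Lia Factorial Classical.
From Coquelicot Require Import Coquelicot.
Open Scope C_scope.

(* Put q(z) = 2F1(-n, b; c; 1/z).  The recurrence of the hypergeometric
   coefficients telescopes to
     z^2 (z-1) q'' + ((2-c) z^2 - (1+n-b) z) q' + n b q = 0.
   For w = w_3 or w_4 the logarithmic derivative g = w'/w is rational, and
   w^-1 (L1_adj - mu L2_adj) w is exactly this operator: for w_3 the pole at z = 1
   cancels because w_3 has an exponent of the equation there.  For w_3 only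
   g matters, and it does not depend on the chosen branches.  The eigenfunctions
   do not vanish identically, since w has no zero and q is a polynomial in 1/z
   with constant term 1. *)

(** * Complex differentiation: comparison of structures and basic rules *)

(* The two canonical normed modules over C have the same norm but different
   uniform structures (max norm on R x R, resp. balls of Cmod). *)
Lemma is_derive_C_AbsRing (f : C -> C) (z l : C) :
  is_derive (V := C_NormedModule) f z l
  <-> is_derive (K := C_AbsRing) (V := AbsRing_NormedModule C_AbsRing) f z l.
Proof.
split; intros [[H1 H2 H3] H4]; split; try (split; assumption); exact H4.
Qed.

(** The max norm is at most [Cmod], and [Cmod] is at most [sqrt 2] times the max norm. This carries
    neighbourhoods given by an open [D] over to [is_derive_ext_loc], which asks for balls of
    [Cmod]. *)
Lemma locally_C_AbsRing (z : C) (P : C -> Prop) :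
  locally (T := C_UniformSpace) z P <-> locally (T := AbsRing_UniformSpace C_AbsRing) z P.
Proof.
split.
- intros [d Hd]; exists d; intros y Hy; apply Hd.
  apply C_NormedModule_mixin_compat1. exact Hy.
- intros [d Hd].
  assert (H : (0 < d / sqrt 2)%R).
  { apply Rdiv_lt_0_compat; [apply cond_pos | apply sqrt_lt_R0; lra]. }
  exists (mkposreal _ H); intros y Hy; apply Hd.
  apply C_NormedModule_mixin_compat2 in Hy.
  replace (pos d) with (sqrt 2 * (d / sqrt 2))%R; [exact Hy|].
  field. apply Rgt_not_eq, sqrt_lt_R0; lra.
Qed.

(** Serves the two derivatives that are estimated by hand: [Cinv], and [Cexp] at 0. *)
Lemma is_derive_C_iff (f : C -> C) (z l : C) :
  is_derive (V := C_NormedModule) f z l <->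
  forall eps : posreal, exists d : posreal, forall y, (Cmod (y - z) < d)%R ->
    (Cmod (f y - f z - (y - z) * l) <= eps * Cmod (y - z))%R.
Proof.
split.
- intros [_ H] eps.
  destruct (H z (fun P HP => HP) eps) as [d Hd].
  exists d; intros y Hy. apply (Hd y), Hy.
- intros H; split.
  + apply (is_linear_scal_l (K := C_AbsRing) (V := C_NormedModule)).
  + intros x Hx.
    (* Differentiability quantifies over every limit [x] of the neighbourhood filter of [z];
       uniqueness of limits leaves only [z]. *)
    assert (E : z = x)
      by exact (is_filter_lim_locally_unique (V := AbsRing_NormedModule C_AbsRing) z x Hx).
    subst x. intros eps. destruct (H eps) as [d Hd].
    exists d; intros y Hy. apply (Hd y Hy).
Qed.

Notation is_C_derive f z l :=
  (is_derive (K := C_AbsRing) (V := C_NormedModule) f (z%C : C) (l%C : C)).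

(** Lets the differentiation rules produce a derivative of their own shape, to be matched with the
    expected one by [ring] or [field]. *)
Lemma is_C_derive_eq (f : C -> C) (z l l' : C) :
  l = l' -> is_C_derive f z l -> is_C_derive f z l'.
Proof. now intros ->. Qed.

Lemma is_C_derive_mult (f g : C -> C) (z df dg : C) :
  is_C_derive f z df -> is_C_derive g z dg ->
  is_C_derive (fun y => f y * g y) z (df * g z + f z * dg).
Proof.
intros Hf Hg. apply is_derive_C_AbsRing.
apply (is_derive_mult (K := C_AbsRing) f g z df dg).
- now apply is_derive_C_AbsRing.
- now apply is_derive_C_AbsRing.
- exact Cmult_comm.
Qed.

Lemma is_C_derive_scal (f : C -> C) (k z df : C) :
  is_C_derive f z df -> is_C_derive (fun y => k * f y) z (k * df).
Proof.
intros Hf. eapply is_C_derive_eq; [|apply is_C_derive_mult;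
  [apply (is_derive_const (V := C_NormedModule) k) | exact Hf]].
change (0 * f z + k * df = k * df). ring.
Qed.

Lemma is_C_derive_comp (f g : C -> C) (z df dg : C) :
  is_C_derive f (g z) df -> is_C_derive g z dg ->
  is_C_derive (fun y => f (g y)) z (dg * df).
Proof.
intros Hf Hg.
apply (is_derive_comp (K := C_AbsRing) (V := C_NormedModule) f g z df dg Hf).
now apply is_derive_C_AbsRing.
Qed.

Lemma is_C_derive_id (z : C) : is_C_derive (fun y => y) z 1.
Proof. apply is_derive_C_AbsRing, (is_derive_id (K := C_AbsRing)). Qed.

Lemma Cinv_neq_0 (z : C) : z <> 0 -> / z <> 0.
Proof.
intros Hz. apply Cmod_gt_0. rewrite Cmod_inv by exact Hz.
now apply Rinv_0_lt_compat, Cmod_gt_0.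
Qed.

Lemma is_C_derive_inv (z : C) : z <> 0 -> is_C_derive Cinv z (- / (z * z)).
Proof.
intros Hz. apply is_derive_C_iff. intros eps.
assert (Hc : (0 < Cmod z)%R) by now apply Cmod_gt_0.
set (c := Cmod z) in *.
(* The error is exactly [(y - z)^2 / (y z^2)]. The bound [c / 2] keeps [Cmod y >= c / 2]; the other
   one then makes [Cmod (y - z) / Cmod (y z^2)] at most [eps]. *)
assert (Hd : (0 < Rmin (c / 2) (eps * c ^ 3 / 2))%R).
{ assert (0 < eps * c ^ 3)%R.
  { apply Rmult_lt_0_compat; [apply cond_pos | now apply pow_lt]. }
  apply Rmin_pos; lra. }
exists (mkposreal _ Hd); simpl pos; intros y Hy.
assert (H1 := Rlt_le_trans _ _ _ Hy (Rmin_l _ _)).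
assert (H2 := Rlt_le_trans _ _ _ Hy (Rmin_r _ _)).
assert (Hyc : (c / 2 <= Cmod y)%R).
{ assert (H := Cmod_triangle y (- (y - z))).
  rewrite Cmod_opp in H. replace (y + - (y - z)) with z in H by ring.
  fold c in H. lra. }
assert (Hy0 : y <> 0) by (apply Cmod_gt_0; lra).
replace (/ y - / z - (y - z) * - / (z * z))
  with ((y - z) * / (y * (z * z)) * (y - z)) by (field; now split).
rewrite !Cmod_mult. apply Rmult_le_compat_r; [apply Cmod_ge_0|].
rewrite Cmod_inv by (repeat apply Cmult_neq_0; assumption).
rewrite !Cmod_mult. fold c.
apply Rle_trans with (eps * c ^ 3 / 2 * / (c / 2 * (c * c)))%R.
- apply Rmult_le_compat; [apply Cmod_ge_0 | | lra |].
  + left; apply Rinv_0_lt_compat. repeat apply Rmult_lt_0_compat; lra.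
  + apply Rinv_le_contravar; [repeat apply Rmult_lt_0_compat; lra|].
    apply Rmult_le_compat_r; [apply Rmult_le_pos; lra | exact Hyc].
- right; field; lra.
Qed.

(** * The complex exponential and its derivative *)

Lemma Cexp_plus (a b : C) : Cexp (a + b) = Cexp a * Cexp b.
Proof.
destruct a as [a a'], b as [b b']; unfold Cexp, Cplus, Cmult; simpl.
rewrite exp_plus, cos_plus, sin_plus; f_equal; ring.
Qed.

Lemma Cexp_neq_0 (z : C) : Cexp z <> 0.
Proof.
intros H. assert (H1 : Cexp z * Cexp (- z) = 1).
{ rewrite <- Cexp_plus, Cplus_opp_r. unfold Cexp; simpl.
  now rewrite exp_0, cos_0, sin_0, Rmult_1_l, Rmult_0_r. }
rewrite H, Cmult_0_l in H1. injection H1; lra.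
Qed.

Lemma Cmod_le_Re_Im (z : C) : (Cmod z <= Rabs (Re z) + Rabs (Im z))%R.
Proof.
destruct z as [x y]; simpl.
replace (x, y) with (RtoC x + Ci * RtoC y)
  by (unfold RtoC, Ci, Cmult, Cplus; simpl; f_equal; ring).
eapply Rle_trans; [apply Cmod_triangle|].
rewrite Cmod_mult, Cmod_Ci, !Cmod_R; lra.
Qed.

Lemma im_le_Cmod (z : C) : (Rabs (Im z) <= Cmod z)%R.
Proof. eapply Rle_trans; [apply Rmax_r | apply Rmax_Cmod]. Qed.

Lemma is_derive_at_0_bound (f : R -> R) (l : R) (eps : posreal) :
  is_derive f 0 l -> exists d : posreal, forall x, (Rabs x < d)%R ->
    (Rabs (f x - f 0 - x * l) <= eps * Rabs x)%R.
Proof.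
intros [_ H]. destruct (H 0%R (fun P HP => HP) eps) as [d Hd].
exists d; intros x Hx.
assert (H' := Hd x). unfold ball in H'; simpl in H'.
unfold AbsRing_ball, abs, minus, plus, opp, norm, scal in H'; simpl in H'.
unfold mult, abs in H'; simpl in H'.
replace (x + - 0)%R with x in H' by ring.
now apply H'.
Qed.

Lemma is_C_derive_Cexp_0 : is_C_derive Cexp 0 1.
Proof.
apply is_derive_C_iff. intros eps.
(* The final estimate collects [3 e m] from the real part and [4 e m] from the imaginary part, where
   [m = Cmod h]. *)
assert (He : exists e : posreal, pos eps = (7 * e)%R).
{ assert (H : (0 < eps / 7)%R) by (assert (H := cond_pos eps); lra).
  exists (mkposreal _ H); simpl; field. }
destruct He as [e He].
destruct (is_derive_at_0_bound exp 1 e) as [d1 H1].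
{ generalize (is_derive_exp 0); now rewrite exp_0. }
destruct (is_derive_at_0_bound cos 0 e) as [d2 H2].
{ generalize (is_derive_cos 0); now rewrite sin_0, Ropp_0. }
destruct (is_derive_at_0_bound sin 1 e) as [d3 H3].
{ generalize (is_derive_sin 0); now rewrite cos_0. }
assert (Hd : (0 < Rmin (Rmin d1 (Rmin d2 d3)) (Rmin 1 e))%R).
{ repeat apply Rmin_pos; try apply cond_pos; lra. }
exists (mkposreal _ Hd); simpl pos; intros h Hh.
replace (h - 0) with h in * by ring.
replace (Cexp 0) with (RtoC 1)
  by (unfold Cexp; simpl; now rewrite exp_0, cos_0, sin_0, Rmult_1_l, Rmult_0_r).
assert (Hx := re_le_Cmod h). assert (Hy := im_le_Cmod h).
apply Rmin_Rgt_l in Hh as [Hh1 Hh2].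
apply Rmin_Rgt_l in Hh1 as [Hh1 Hh3]. apply Rmin_Rgt_l in Hh2 as [Hh2 Hh4].
apply Rmin_Rgt_l in Hh3 as [Hh3 Hh5].
set (x := Re h) in *. set (y := Im h) in *. set (m := Cmod h) in *.
specialize (H1 x ltac:(lra)). specialize (H2 y ltac:(lra)). specialize (H3 y ltac:(lra)).
rewrite exp_0 in H1. rewrite cos_0 in H2. rewrite sin_0 in H3.
eapply Rle_trans; [apply Cmod_le_Re_Im|].
(* Both parts are rewritten through the first-order remainders of [exp], [cos] and [sin] at 0; only
   the product [x * y] is left over, and it is small because [Rabs x < e]. *)
replace (Re (Cexp h - 1 - h * 1)) with
  ((exp x - 1 - x * 1) * cos y + (1 + x) * (cos y - 1 - y * 0))%R
  by (unfold x, y; destruct h; simpl; ring).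
replace (Im (Cexp h - 1 - h * 1)) with
  ((exp x - 1 - x * 1) * sin y + (1 + x) * (sin y - 0 - y * 1) + x * y)%R
  by (unfold x, y; destruct h; simpl; ring).
assert (Hm : (0 <= m)%R) by apply Cmod_ge_0.
assert (Hex : (e * Rabs x <= e * m)%R)
  by (apply Rmult_le_compat_l; [left; apply cond_pos | exact Hx]).
assert (Hey : (e * Rabs y <= e * m)%R)
  by (apply Rmult_le_compat_l; [left; apply cond_pos | exact Hy]).
assert (Hc : (Rabs (cos y) <= 1)%R) by (apply Rabs_le, COS_bound).
assert (Hs : (Rabs (sin y) <= 1)%R) by (apply Rabs_le, SIN_bound).
assert (Hx1 : (Rabs (1 + x) <= 2)%R).
{ eapply Rle_trans; [apply Rabs_triang|]. rewrite Rabs_R1; lra. }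
assert (B : forall a b A B, (Rabs a <= A -> Rabs b <= B -> Rabs (a * b) <= A * B)%R).
{ intros; rewrite Rabs_mult; apply Rmult_le_compat; auto using Rabs_pos. }
assert (T1 := B _ _ _ _ (Rle_trans _ _ _ H1 Hex) Hc).
assert (T2 := B _ _ _ _ Hx1 (Rle_trans _ _ _ H2 Hey)).
assert (T3 := B _ _ _ _ (Rle_trans _ _ _ H1 Hex) Hs).
assert (T4 := B _ _ _ _ Hx1 (Rle_trans _ _ _ H3 Hey)).
assert (T5 := B x y e m ltac:(lra) ltac:(lra)).
rewrite He.
assert (B' : forall a b A B, (Rabs a <= A -> Rabs b <= B -> Rabs (a + b) <= A + B)%R).
{ intros; eapply Rle_trans; [apply Rabs_triang | now apply Rplus_le_compat]. }
assert (T6 := B' _ _ _ _ T1 T2).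
assert (T7 := B' _ _ _ _ (B' _ _ _ _ T3 T4) T5).
lra.
Qed.

(** The functional equation [Cexp y = Cexp z * Cexp (y - z)] reduces the claim to the derivative at
    0. *)
Lemma is_C_derive_Cexp (z : C) : is_C_derive Cexp z (Cexp z).
Proof.
apply (is_derive_ext (fun y => Cexp z * Cexp (y - z))).
{ intros y. rewrite <- Cexp_plus. f_equal. change (z + (y - z) = y). ring. }
eapply is_C_derive_eq; [|apply is_C_derive_mult;
  [apply (is_derive_const (V := C_NormedModule) (Cexp z))|
   apply (is_C_derive_comp Cexp (fun y => y - z))]].
3:{ apply (is_derive_minus (V := C_NormedModule) (fun y => y) (fun _ => z));
    [apply is_C_derive_id | apply (is_derive_const (V := C_NormedModule) z)]. }
2:{ replace (z - z) with (RtoC 0) by ring. apply is_C_derive_Cexp_0. }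
change (0 * Cexp (z - z) + Cexp z * ((1 - 0) * 1) = Cexp z). ring.
Qed.

(** * Derivatives of power branches and second derivatives on open sets *)

(** Near [z], [g = exp l] gives [l' = g'/g], and [f = exp (s l)] gives [f' = s l' f]. The local
    logarithm [l] drops out of [f'/f], which is therefore the same for all branches. *)
Lemma is_power_branch_derive (D : C -> Prop) (g f : C -> C) (s : R) (z dg : C) :
  is_power_branch D g s f -> D z -> is_C_derive g z dg ->
  f z <> 0 /\ is_C_derive f z (s * dg / g z * f z).
Proof.
intros Hf Dz Hg. destruct (Hf z Dz) as [l Hl].
destruct (locally_singleton _ _ Hl) as [[dl Hdl] [Egz Efz]].
assert (Hgz : g z <> 0) by (rewrite <- Egz; apply Cexp_neq_0).
split; [rewrite Efz; apply Cexp_neq_0|].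
assert (Edl : dg = dl * g z).
{ rewrite <- (is_C_derive_unique g z _ Hg). apply is_C_derive_unique.
  apply (is_derive_ext_loc (fun y => Cexp (l y))).
  - apply locally_C_AbsRing. refine (filter_imp _ _ _ Hl). now intros y [_ [E _]].
  - rewrite <- Egz. apply is_C_derive_comp; [apply is_C_derive_Cexp | exact Hdl]. }
apply (is_derive_ext_loc (fun y => Cexp (s * l y))).
- apply locally_C_AbsRing. refine (filter_imp _ _ _ Hl). now intros y [_ [_ E]].
- eapply is_C_derive_eq; [|apply is_C_derive_comp; [apply is_C_derive_Cexp|]].
  2:{ apply is_C_derive_mult; [|exact Hdl].
      apply (is_derive_const (V := C_NormedModule) (RtoC s)). }
  change ((0 * l z + s * dl) * Cexp (s * l z) = s * dg / g z * f z).
  rewrite Efz, Edl. field. exact Hgz.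
Qed.

(** [C_derive f] is known to equal [f1] only on [D]; since [D] is open, they agree near each of its
    points, so [C_derive f] inherits the derivative of [f1]. *)
Lemma C_derive_twice (D : C -> Prop) (f f1 f2 : C -> C) :
  open (T := C_UniformSpace) D ->
  (forall z, D z -> is_C_derive f z (f1 z)) ->
  (forall z, D z -> is_C_derive f1 z (f2 z)) ->
  twice_differentiable_on D f /\
  forall z, D z -> C_derive f z = f1 z /\ C_derive (C_derive f) z = f2 z.
Proof.
intros OD H1 H2.
assert (H : forall z, D z -> is_C_derive (C_derive f) z (f2 z)).
{ intros z Dz. apply (is_derive_ext_loc f1); [|now apply H2].
  apply locally_C_AbsRing. refine (filter_imp _ _ _ (OD z Dz)).
  intros y Dy. symmetry. now apply is_C_derive_unique, H1. }
split.
- intros z Dz; split; eexists; [now apply H1 | now apply H].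
- intros z Dz; split; apply is_C_derive_unique; auto.
Qed.

(** * Polynomials in 1/z and the Euler operator *)

(** With arbitrary coefficients, the class is stable under [z d/dz], which acts on the sequence [c]
    alone. *)
Definition inv_poly (c : nat -> C) (n : nat) (z : C) : C :=
  sum_n (G := C_AbelianMonoid) (fun k => c k * (/ z) ^ k) n.

Lemma inv_poly_0 (c : nat -> C) (z : C) : inv_poly c 0 z = c 0%nat.
Proof. unfold inv_poly; rewrite sum_O; simpl; ring. Qed.

Lemma inv_poly_S (c : nat -> C) (n : nat) (z : C) :
  inv_poly c (S n) z = inv_poly c n z + c (S n) * (/ z) ^ S n.
Proof. unfold inv_poly; now rewrite sum_Sn. Qed.

(* The coefficients of z d/dz applied to the sum of the c_k z^(-k). *)
Definition euler_coeff (c : nat -> C) (k : nat) : C := - INR k * c k.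

Lemma RtoC_INR_S (k : nat) : RtoC (INR (S k)) = INR k + 1.
Proof. now rewrite S_INR, RtoC_plus. Qed.

Lemma RtoC_INR_S_neq_0 (k : nat) : INR k + 1 <> 0.
Proof.
rewrite <- RtoC_INR_S. intros X; apply RtoC_inj in X; revert X; now apply not_0_INR.
Qed.

Lemma is_C_derive_inv_pow (k : nat) (z : C) : z <> 0 ->
  is_C_derive (fun y => (/ y) ^ k) z (- INR k * (/ z) ^ S k).
Proof.
intros Hz. induction k as [|k IH].
- eapply is_C_derive_eq; [|apply (is_derive_const (V := C_NormedModule) (RtoC 1))].
  change (RtoC 0 = - 0 * (/ z) ^ 1). ring.
- eapply is_C_derive_eq;
    [|apply (is_C_derive_mult Cinv _ z _ _ (is_C_derive_inv z Hz) IH)].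
  rewrite S_INR, RtoC_plus; simpl. field. exact Hz.
Qed.

Lemma is_C_derive_inv_poly (c : nat -> C) (n : nat) (z : C) : z <> 0 ->
  is_C_derive (inv_poly c n) z (/ z * inv_poly (euler_coeff c) n z).
Proof.
intros Hz.
assert (T : forall k, is_C_derive (fun y => c k * (/ y) ^ k) z
                        (/ z * (euler_coeff c k * (/ z) ^ k))).
{ intros k. eapply is_C_derive_eq; [|apply is_C_derive_mult;
    [apply (is_derive_const (V := C_NormedModule) (c k))
    |now apply is_C_derive_inv_pow]].
  change (0 * (/ z) ^ k + c k * (- INR k * (/ z) ^ S k)
          = / z * (euler_coeff c k * (/ z) ^ k)).
  unfold euler_coeff; simpl; ring. }
induction n as [|n IH].
- apply (is_derive_ext (fun y => c 0%nat * (/ y) ^ 0)).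
  + intros y; rewrite inv_poly_0; apply Cmult_1_r.
  + eapply is_C_derive_eq; [|apply T]. rewrite inv_poly_0; simpl; ring.
- apply (is_derive_ext (fun y => inv_poly c n y + c (S n) * (/ y) ^ S n)).
  + intros y; now rewrite inv_poly_S.
  + eapply is_C_derive_eq;
      [|apply (is_derive_plus (V := C_NormedModule) (inv_poly c n)); [exact IH | apply T]].
    rewrite inv_poly_S.
    change (/ z * inv_poly (euler_coeff c) n z
      + / z * (euler_coeff c (S n) * (/ z) ^ S n) =
      / z * (inv_poly (euler_coeff c) n z + euler_coeff c (S n) * (/ z) ^ S n)).
    ring.
Qed.

(* The operator z d/dz + (n + 1) kills the term of index n + 1 and multiplies
   c_0 by n + 1, whence an induction on n. *)
Lemma inv_poly_eq_0 (D : C -> Prop) (c : nat -> C) (n : nat) :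
  open (T := C_UniformSpace) D -> (exists z, D z) ->
  (forall z, D z -> z <> 0) ->
  (forall z, D z -> inv_poly c n z = 0) -> c 0%nat = 0.
Proof.
intros OD [z0 Dz0] ND. revert c.
induction n as [|n IH]; intros c H.
{ rewrite <- (H z0 Dz0). symmetry; apply inv_poly_0. }
set (c' := fun k => INR (S n) * c k + euler_coeff c k).
assert (E : forall m z, inv_poly c' m z
              = INR (S n) * inv_poly c m z + inv_poly (euler_coeff c) m z).
{ intros m z; induction m as [|m IHm].
  - rewrite !inv_poly_0; reflexivity.
  - rewrite !inv_poly_S, IHm; unfold c'; ring. }
assert (H0 : c' 0%nat = 0).
{ apply IH. intros z Dz. assert (Hz := ND z Dz).
  assert (Ed : / z * inv_poly (euler_coeff c) (S n) z = 0).
  { rewrite <- (is_C_derive_unique _ _ _ (is_C_derive_inv_poly c (S n) z Hz)).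
    apply is_C_derive_unique, (is_derive_ext_loc (fun _ => RtoC 0)).
    - apply locally_C_AbsRing. refine (filter_imp _ _ _ (OD z Dz)).
      intros y Dy. symmetry. exact (H y Dy).
    - apply (is_derive_const (V := C_NormedModule) (RtoC 0)). }
  assert (Ed' : inv_poly (euler_coeff c) (S n) z = 0).
  { transitivity (z * (/ z * inv_poly (euler_coeff c) (S n) z)).
    - field; exact Hz.
    - rewrite Ed; ring. }
  assert (Es := E (S n) z). rewrite (H z Dz), Ed', inv_poly_S in Es.
  replace (c' (S n)) with (RtoC 0) in Es by (unfold c', euler_coeff; ring).
  transitivity (inv_poly c' n z + 0 * (/ z) ^ S n); [ring | rewrite Es; ring]. }
assert (Hn : RtoC (INR (S n)) <> 0).
{ rewrite RtoC_INR_S; apply RtoC_INR_S_neq_0. }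
transitivity (/ INR (S n) * c' 0%nat); [|rewrite H0; ring].
unfold c', euler_coeff; change (INR 0) with 0%R. field. exact Hn.
Qed.

(** * The hypergeometric equation in 1/z and its conjugation by a weight *)

(** Copies the summand of [hyp2F1_neg], so that [hyp2F1_neg n b c (/ z)] is convertible to an
    [inv_poly]. *)
Definition hyp_coeff (n : nat) (b c : C) (k : nat) : C :=
  pochhammer (- INR n) k * pochhammer b k / (pochhammer c k * INR (fact k)).

Lemma pochhammer_neq_0 (c : C) (n m : nat) :
  (forall k : nat, (k < n)%nat -> c <> - INR k) -> (m <= n)%nat ->
  pochhammer c m <> 0.
Proof.
intros H. induction m as [|m IH]; intros Hm; simpl.
- intros X; injection X; lra.
- apply Cmult_neq_0; [apply IH; now apply le_S_n, le_S|].
  intros X. apply (H m Hm).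
  replace c with (c + INR m - INR m) by ring. rewrite X; ring.
Qed.

(** The ratio of consecutive hypergeometric terms, cleared of denominators; [m < n] ensures that the
    Pochhammer symbol of [c] of index [m + 1] is nonzero. *)
Lemma hyp_coeff_S (n : nat) (b c : C) (m : nat) :
  (forall k : nat, (k < n)%nat -> c <> - INR k) -> (m < n)%nat ->
  (INR m + 1) * (c + INR m) * hyp_coeff n b c (S m)
  = (INR m - INR n) * (b + INR m) * hyp_coeff n b c m.
Proof.
intros H Hm. unfold hyp_coeff.
assert (H1 := pochhammer_neq_0 c n (S m) H Hm). simpl in H1.
rewrite fact_simpl, mult_INR, RtoC_mult, RtoC_INR_S; simpl pochhammer.
assert (Hf : RtoC (INR (fact m)) <> 0).
{ intros X; apply RtoC_inj in X; revert X; apply INR_fact_neq_0. }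
assert (Hk := RtoC_INR_S_neq_0 m).
field. repeat split; auto.
- intros X; apply H1; rewrite X; ring.
- intros X; apply H1; rewrite X; ring.
Qed.

(* Telescoping: the recurrence of the coefficients leaves only the boundary
   term of the partial sum, which vanishes at m = n. *)
Lemma hyp_inv_poly_telescope (n : nat) (b c z : C) (m : nat) :
  z <> 0 -> (forall k : nat, (k < n)%nat -> c <> - INR k) -> (m <= n)%nat ->
  let a := hyp_coeff n b c in
  (z - 1) * (inv_poly (euler_coeff (euler_coeff a)) m z
             - inv_poly (euler_coeff a) m z)
  + ((2 - c) * z - (1 + INR n - b)) * inv_poly (euler_coeff a) m z
  + INR n * b * inv_poly a m z
  = (INR n - INR m) * (b + INR m) * a m * (/ z) ^ m.
Proof.
intros Hz H Hm a. induction m as [|m IH].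
- rewrite !inv_poly_0; unfold euler_coeff; simpl; ring.
- specialize (IH (Nat.lt_le_incl _ _ Hm)).
  rewrite !inv_poly_S.
  set (A0 := inv_poly a m z) in *.
  set (A1 := inv_poly (euler_coeff a) m z) in *.
  set (A2 := inv_poly (euler_coeff (euler_coeff a)) m z) in *.
  unfold euler_coeff. rewrite RtoC_INR_S.
  assert (R := hyp_coeff_S n b c m H Hm). fold a in R.
  (* The term of index [m + 1] contributes at the powers [-m] and [-(m + 1)] of [z]. By [R] the
     first contribution cancels the boundary term of [IH]; the second is the new boundary term. *)
  transitivity ((z - 1) * (A2 - A1) + ((2 - c) * z - (1 + INR n - b)) * A1
    + INR n * b * A0 + ((INR m + 1) * (c + INR m) * a (S m)
    + (INR n - (INR m + 1)) * (b + (INR m + 1)) * a (S m) * / z) * (/ z) ^ m).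
  { simpl Cpow. field. exact Hz. }
  rewrite IH, R. simpl Cpow. ring.
Qed.

(* Here g = w'/w.  The hypothesis on q0, q1, q2 says that conjugation by w turns
   L1_adj - mu L2_adj into the equation of 2F1(-n, b; c; 1/z), written in z. *)
Lemma is_gen_eigenfunction_hyp (D : C -> Prop) (alpha beta : R) (n : nat)
    (mu b c K : C) (w g g1 : C -> C) :
  is_domain D -> (forall z, D z -> z <> 0) ->
  (forall k : nat, (k < n)%nat -> c <> - INR k) -> K <> 0 ->
  (forall z, D z -> w z <> 0 /\ is_C_derive w z (g z * w z)) ->
  (forall z, D z -> is_C_derive g z (g1 z)) ->
  (forall z q0 q1 q2, D z ->
     z ^ 2 * (z - 1) * q2 + ((2 - c) * z ^ 2 - (1 + INR n - b) * z) * q1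
     + INR n * b * q0 = 0 ->
     z ^ 2 * (z - 1) * (q2 + 2 * g z * q1 + (g1 z + g z * g z) * q0)
     - z * (2 + alpha + (-3 + beta) * z) * (q1 + g z * q0)
     + (1 - beta) * z * q0
     - mu * (z * (z - 1) * (q1 + g z * q0) + (-1 - alpha + z) * q0) = 0) ->
  is_gen_eigenfunction D (L1_adj alpha beta) (L2_adj alpha) mu
    (fun z => w z * (K * hyp2F1_neg n b c (/ z))).
Proof.
intros [[z0 Dz0] [OD _]] ND Hc HK Hw Hg Hode.
set (a := hyp_coeff n b c).
change (fun z => w z * (K * hyp2F1_neg n b c (/ z)))
  with (fun z => w z * (K * inv_poly a n z)).
set (q := inv_poly a n).
set (q1 := fun z => / z * inv_poly (euler_coeff a) n z).
set (q2 := fun z => - / (z * z) * inv_poly (euler_coeff a) n z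
             + / z * (/ z * inv_poly (euler_coeff (euler_coeff a)) n z)).
assert (Dq : forall z, D z -> is_C_derive q z (q1 z)).
{ intros z Dz. now apply is_C_derive_inv_poly, ND. }
assert (Dq1 : forall z, D z -> is_C_derive q1 z (q2 z)).
{ intros z Dz. apply (is_C_derive_mult Cinv).
  - now apply is_C_derive_inv, ND.
  - now apply is_C_derive_inv_poly, ND. }
(* From [w' = g w], the first two derivatives of [w K q] are [w K] times [q' + g q] and
   [q'' + 2 g q' + (g' + g^2) q]. *)
destruct (C_derive_twice D (fun z => w z * (K * q z))
  (fun z => w z * (K * (q1 z + g z * q z)))
  (fun z => w z * (K * (q2 z + 2 * g z * q1 z + (g1 z + g z * g z) * q z))))
  as [Htwice HC].
- exact OD.
- intros z Dz. eapply is_C_derive_eq;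
    [|apply is_C_derive_mult; [apply Hw, Dz | apply is_C_derive_scal, Dq, Dz]].
  cbv beta; ring.
- intros z Dz. eapply is_C_derive_eq;
    [|apply is_C_derive_mult; [apply Hw, Dz |
      apply is_C_derive_scal, (is_derive_plus (V := C_NormedModule) q1);
      [apply Dq1, Dz | apply is_C_derive_mult; [apply Hg, Dz | apply Dq, Dz]]]].
  change (g z * w z * (K * (q1 z + g z * q z))
    + w z * (K * (q2 z + (g1 z * q z + g z * q1 z)))
    = w z * (K * (q2 z + 2 * g z * q1 z + (g1 z + g z * g z) * q z))).
  ring.
- split; [exact Htwice | split].
  + apply NNPP; intros Hno.
    assert (Ha : a 0%nat = 0).
    { apply (inv_poly_eq_0 D a n OD); [now exists z0 | exact ND |].
      intros z Dz. apply NNPP; intros Hq. apply Hno. exists z; split; [exact Dz|].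
      apply Cmult_neq_0; [now apply Hw | now apply Cmult_neq_0]. }
    revert Ha. unfold a, hyp_coeff; simpl.
    replace (1 * 1 / (1 * 1)) with (RtoC 1) by field.
    intros X; injection X; lra.
  + intros z Dz. unfold L1_adj, L2_adj.
    destruct (HC z Dz) as [-> ->].
    assert (Hz := ND z Dz).
    assert (T := hyp_inv_poly_telescope n b c z n Hz Hc (le_n n)).
    cbv zeta in T. fold a in T.
    replace ((INR n - INR n) * (b + INR n) * a n * (/ z) ^ n) with (RtoC 0) in T by ring.
    assert (O := Hode z (q z) (q1 z) (q2 z) Dz).
    (* The factor [w z * K] comes out; the cofactor vanishes by [O], whose premise is the telescoped
       identity [T] at [m = n]. *)
    transitivity (w z * K * 0); [rewrite <- O; [cbv beta|]|ring].
    * ring.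
    * rewrite <- T. unfold q, q1, q2. field. exact Hz.
Qed.

(** * Application to the HR polynomials *)

(** The equation [1 - b - n = -k] means [b = -(n - 1 - k)], and [k -> n - 1 - k] reverses the range
    [0..n-1]; so the condition on [b] is also the one on the lower parameter. *)
Lemma HR_well_defined_hyp (n : nat) (a b : C) :
  HR_well_defined n a b ->
  pochhammer b n / pochhammer (a + 1) n <> 0 /\
  forall k : nat, (k < n)%nat -> 1 - b - INR n <> - INR k.
Proof.
intros [Ha Hb]; split.
- apply Cmult_neq_0; [now apply (pochhammer_neq_0 b n) | now apply Cinv_neq_0].
- intros k Hk X. apply (Hb (n - 1 - k)%nat); [lia|].
  rewrite !minus_INR, !RtoC_minus by lia. change (INR 1) with 1%R.
  replace b with (1 - INR n - (1 - b - INR n)) by ring. rewrite X; ring.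
Qed.

Theorem mainTheorem8 (alpha beta : R) (n : nat)
    (wd3 : HR_well_defined n (beta - 1) (alpha + 1))
    (wd4 : HR_well_defined n (- alpha - 1) (- beta + 1)) :
  (forall (D : C -> Prop) (w3 : C -> C),
      is_domain D ->
      (forall z, D z -> z <> 0 /\ z <> 1) ->
      is_w3 D alpha beta w3 ->
      is_gen_eigenfunction D (L1_adj alpha beta) (L2_adj alpha)
        (mu3 alpha beta n) (fun z => w3 z * p3 alpha beta n z))
  /\
  (forall D : C -> Prop,
      is_domain D ->
      (forall z, D z -> z <> 0) ->
      is_gen_eigenfunction D (L1_adj alpha beta) (L2_adj alpha)
        (mu4 n) (fun z => w4 z * p4 alpha beta n z)).
Proof.
split.
- intros D w3 HD ND (u & v & Hu & Hv & Hw).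
  destruct (HR_well_defined_hyp _ _ _ wd3) as [HK Hc].
  assert (ND1 : forall z, D z -> 1 - z <> 0).
  { intros z Dz X. apply (ND z Dz). replace z with (1 - (1 - z)) by ring.
    rewrite X; ring. }
  assert (D1 : forall z, is_C_derive (fun y => 1 - y) z (- (1))).
  { intros z. eapply is_C_derive_eq; [|apply (is_derive_minus
      (V := C_NormedModule) (fun _ => RtoC 1) (fun y => y));
      [apply (is_derive_const (V := C_NormedModule)) | apply is_C_derive_id]].
    change (RtoC 0 - 1 = - (1)). ring. }
  set (s := RtoC alpha + beta).
  (* The logarithmic derivative of [(1-z)^s (-z)^(-1-s)] and its derivative. The upper parameter is
     [beta], the lower one [-alpha - n]. *)
  apply (is_gen_eigenfunction_hyp D alpha beta n _ (beta - 1 + 1) _ _ w3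
    (fun z => s * (- / (1 - z)) + (- (1) - s) * / z)
    (fun z => s * (- / ((1 - z) * (1 - z))) + (- (1) - s) * - / (z * z)));
    [exact HD | apply ND | exact Hc | exact HK | | |].
  + intros z Dz.
    destruct (is_power_branch_derive D _ u _ z (- (1)) Hu Dz) as [Hu0 Hu1].
    { apply D1. }
    destruct (is_power_branch_derive D _ v _ z (- (1)) Hv Dz) as [Hv0 Hv1].
    { apply (is_derive_opp (V := C_NormedModule) (fun y => y)), is_C_derive_id. }
    rewrite (Hw z Dz). split; [now apply Cmult_neq_0|].
    apply (is_derive_ext_loc (fun y => u y * v y)).
    { apply locally_C_AbsRing. refine (filter_imp _ _ _ (proj1 (proj2 HD) z Dz)).
      intros y Dy; symmetry; now apply Hw. }
    eapply is_C_derive_eq; [|apply is_C_derive_mult; [exact Hu1 | exact Hv1]].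
    rewrite !RtoC_minus, RtoC_plus. unfold s. field.
    split; [now apply ND | now apply ND1].
  + intros z Dz. destruct (ND z Dz) as [Hz _]. assert (Hz1 := ND1 z Dz).
    assert (Hinv : is_C_derive (fun y => / (1 - y)) z
      (- (1) * - / ((1 - z) * (1 - z)))).
    { apply (is_C_derive_comp Cinv (fun y => 1 - y));
        [now apply is_C_derive_inv | apply D1]. }
    eapply is_C_derive_eq; [|apply (is_derive_plus (V := C_NormedModule)
      (fun y => s * (- / (1 - y))) (fun y => (- (1) - s) * / y));
      [apply is_C_derive_scal, (is_derive_opp (V := C_NormedModule)), Hinv
      |apply is_C_derive_scal, is_C_derive_inv, Hz]].
    change (s * - (- (1) * - / ((1 - z) * (1 - z))) + (- (1) - s) * - / (z * z)
      = s * (- / ((1 - z) * (1 - z))) + (- (1) - s) * - / (z * z)). ring.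
  (* For this [mu3] the coefficients of [q0], [q1] and [q2] on the two sides agree as rational
     functions of [z], so [field] applies with [q0], [q1], [q2] free. *)
  + intros z q0 q1 q2 Dz E. destruct (ND z Dz) as [Hz _]. assert (Hz1 := ND1 z Dz).
    rewrite <- E. unfold mu3, s. rewrite !RtoC_minus, RtoC_opp. field. now split.
- intros D HD ND.
  destruct (HR_well_defined_hyp _ _ _ wd4) as [HK Hc].
  (* The logarithmic derivative of [1/z] is regular at [z = 1], so [D] may contain that point. The
     upper parameter is [-alpha], the lower one [beta - n]. *)
  apply (is_gen_eigenfunction_hyp D alpha beta n _ (- alpha - 1 + 1) _ _ w4
    (fun z => - / z) (fun z => - - / (z * z)));
    [exact HD | exact ND | exact Hc | exact HK | | |].
  + intros z Dz. assert (Hz := ND z Dz). split; [now apply Cinv_neq_0|].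
    eapply is_C_derive_eq; [|now apply is_C_derive_inv].
    unfold w4; field; exact Hz.
  + intros z Dz. apply (is_derive_opp (V := C_NormedModule) Cinv).
    now apply is_C_derive_inv, ND.
  + intros z q0 q1 q2 Dz E. assert (Hz := ND z Dz).
    rewrite <- E. unfold mu4. rewrite RtoC_minus, RtoC_opp. field. exact Hz.
Qed.
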